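(* Let $n\ge 1$ and let $\alpha_1,\dots,\alpha_n\in\mathbb{R}$ be a joint algebraic tuple. Then there exists a constant $C$ depending only on $\alpha_1,\dots,\alpha_n$ such that for every $\ell\in\mathbb{N}$ $$\liminf_{k\to\infty} k^{1/n}\,\|\langle k\ell(\alpha_1,\dots,\alpha_n)\rangle\|_\infty\le \frac{C}{\ell^{1/n}}.$$ Moreover, for every prime $p$, $$\liminf_{k\to\infty}\,(k|k|_p)^{1/n}\,\|\langle k(\alpha_1,\dots,\alpha_n)\rangle\|_\infty=0.$$
   Context: $\mathbb{N}$ denotes the positive integers, and the $\liminf$ is over $k\in\mathbb{N}$. An $n$-tuple of real numbers $\alpha_1,\dots,\alpha_n$ is a joint algebraic tuple if the $\mathbb{Q}$-linear span of $\{1,\alpha_1,\dots,\alpha_n\}$ is a totally real number field of degree $n+1$. For $v\in\mathbb{R}^n$, $\|\langle v\rangle\|_\infty$ denotes the $\ell^\infty$ distance from $v$ to the nearest integer vector, i.e. $\min_{z\in\mathbb{Z}^n}\|v-z\|_\infty$. $|\cdot|_p$ is the $p$-adic absolute value (with $|p|_p=1/p$). *)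

(* Defs.v *)
From HB Require Import structures.
From mathcomp Require Import all_boot all_order all_algebra all_field.
From mathcomp Require Import all_classical all_reals all_analysis.
From mathcomp Require Import complex.

Set Implicit Arguments.
Unset Strict Implicit.
Unset Printing Implicit Defensive.

Import Order.TTheory GRing.Theory Num.Theory.
Import numFieldNormedType.Exports.

Local Open Scope classical_set_scope.
Local Open Scope ring_scope.

(* The Q-linear span of {1, a_1, ..., a_n} in R. *)
Definition qspan1 (R : realType) (n : nat) (a : 'rV[R]_n) : set R :=
  [set x | exists (q0 : rat) (q : 'rV[rat]_n),
     x = ratr q0 + \sum_(i < n) ratr (q 0 i) * a 0 i].

Definition totally_real (R : realType) (K : fieldExtType rat) : Prop :=
  forall (sigma : {rmorphism K -> R[i]}) (x : K), complex.Im (sigma x) = 0.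

(* S is a subfield of R, given as the image of an abstract number field K;
   the embedding iota identifies K with S. *)
Definition totally_real_number_field (R : realType) (d : nat) (S : set R) :
    Prop :=
  exists (K : fieldExtType rat) (iota : {rmorphism K -> R}),
    [/\ range iota = S, \dim {:K} = d & totally_real R K].

Definition joint_algebraic_tuple (R : realType) (n : nat) (a : 'rV[R]_n) :
    Prop :=
  totally_real_number_field n.+1 (qspan1 a).

(* The norm of 'rV[R]_n is the l^oo norm, and the infimum is attained. *)
Definition dist_to_int (R : realType) (n : nat) (v : 'rV[R]_n) : R :=
  inf (range (fun z : 'rV[int]_n => `|v - map_mx intr z|)).

Definition padic_abs (R : realType) (p k : nat) : R :=
  if k == 0%N then 0 else p%:R ^- logn p k.

(* Main.v *)
Require Import Defs.
From mathcomp Require Import all_boot all_order all_algebra all_field.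
From mathcomp Require Import all_classical all_reals all_analysis.
From mathcomp Require Import ring lra zify.

Set Implicit Arguments.
Unset Strict Implicit.
Unset Printing Implicit Defensive.

Import Order.TTheory GRing.Theory Num.Theory.
Import numFieldNormedType.Exports.

Local Open Scope ring_scope.

(** Write A = (1, alpha_1, ..., alpha_n). Dirichlet's theorem
    gives integer vectors w close to multiples q A, with r ^ n comparable to q
    and an error at most 1 / r, for arbitrarily large r. The difficulty in the
    first claim is to obtain denominators divisible by l without losing more
    than a constant factor independent of l.

    The field structure does this. The entries of A span a field, so for some
    integer D > 0 every D A_i A_j is an integer combination of the entries of
    A. Hence for an integer vector y and eta = sum_k y_k A_k there is an
    integer matrix having A as an eigenvector with eigenvalue D eta, and its
    row of index 0 can be taken to be D y because A_0 = 1. Applied to an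
    integer vector w' close to the line R A, it yields another such vector,
    with denominator Q = D (y . w') and with an error multiplied by at most
    O(|y|) (lemma [multiplied_approximation]).

    By the infinite pigeonhole principle, fix one Dirichlet approximation
    (r, q, w) such that arbitrarily large approximations (r', q', w') satisfy
    w' = w modulo l. Siegel's lemma for the single equation y . w = 0 gives a
    nonzero y with |y| = O(r) (lemma [orthogonal_vector]). Then
    - y . w' = y . w = 0 modulo l, so l divides Q;
    - q eta = - y . (w - q A) = O(1), so eta = O(r ^ -n), and
      Q = D q' eta + O(1) = O((r' / r) ^ n);
    - Q tends to infinity with r', since eta <> 0 by linear independence;
    - the new error is O(r / r').
    The factors r' / r cancel in Q * error ^ n, which is bounded by a constant
    depending on A, D and the structure constants, but neither on l nor on
    (r, q, w). This is lemma [approximant_multiple]. In terms of the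
    trace form, w and w' are the coordinates of elements xi and xi' of the dual
    of the module spanned by A, and y . w is the trace of eta xi. All conjugates
    of eta xi are bounded, so eta inverts xi up to a factor of bounded size;
    then eta xi' has trace divisible by l, and the multiplication by eta has
    compensated the size of xi.

    The second claim follows from the first with l = p ^ m: for the multiple
    k p ^ m, the p-adic factor removes at least p ^ m from the denominator, so
    the limit inferior is at most C / p ^ (m / n) for every m. *)

(** * Pigeonhole principles *)

Lemma pigeonhole (T T' : finType) (f : T -> T') :
  (#|T'| < #|T|)%N -> exists x y, x != y /\ f x = f y.
Proof.
move=> lt_card; have /injectivePn[x [y xy fxy]] : ~~ injectiveb f.
  by apply/negP => /injectiveP/leq_card; rewrite leqNgt lt_card.
by exists x, y.
Qed.

Lemma infinite_pigeonhole (T : finType) (f : nat -> T) :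
  exists t, forall N, exists2 m, (N <= m)%N & f m = t.
Proof.
apply: contrapT => /forallNP no_t.
have /choice[b bP] t : exists N, forall m, (N <= m)%N -> f m <> t.
  have /existsNP[N NP] := no_t t.
  by exists N => m Nm fm; apply: NP; exists m.
by apply: (bP (f (\max_t b t)%N) _ _ erefl); exact: leq_bigmax.
Qed.

(** * Dirichlet's theorem and Siegel's lemma *)

(** The boxes are the cells of side 1 / N of the unit cube; N ^ n + 1 multiples
    of A cannot lie in distinct cells modulo 1. The coordinate of index 0 needs
    no box, as its multiples are integers. *)
Lemma dirichlet_simultaneous (R : realType) n (A : 'I_n.+1 -> R) N :
  A ord0 = 1 -> (0 < N)%N ->
  exists q (w : 'I_n.+1 -> int),
    (0 < q <= N ^ n)%N /\
    forall k, `|(w k)%:~R - q%:R * A k| <= N%:R^-1.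
Proof.
case: N => // N A0 _; pose fr (x : R) := x - (Num.floor x)%:~R.
have fr_itv x : 0 <= fr x < 1.
  have /andP[] := floor_itv x; rewrite /fr intrD => *; lra.
have tr_lt x : (Num.truncn (N.+1%:R * fr x) < N.+1)%N.
  have /andP[f0 f1] := fr_itv x.
  by rewrite truncn_lt_nat ?mulr_ge0// gtr_pMr.
pose box (q : 'I_(N.+1 ^ n).+1) : {ffun 'I_n -> 'I_N.+1} :=
  [ffun i => Ordinal (tr_lt (q%:R * A (lift ord0 i)))].
have [|x [y [xy bxy]]] := @pigeonhole _ _ box.
  by rewrite card_ffun !card_ord.
wlog lt_xy : x y xy bxy / (x < y)%N.
  move=> wl; case: (ltngtP x y) => [|yx|/val_inj e]; first exact: wl.
    by apply: wl yx; rewrite 1?eq_sym.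
  by rewrite e eqxx in xy.
pose w k := Num.floor (y%:R * A k) - Num.floor (x%:R * A k).
exists (y - x)%N, w; split.
  by rewrite subn_gt0 lt_xy (leq_trans (leq_subr _ _))// -ltnS.
move=> k; rewrite natrB 1?ltnW// /w intrB mulrBl.
case: (unliftP ord0 k) => [i ->|->]; last first.
  by rewrite A0 !mulr1 !(intrKfloor (Posz _)) subrr normr0 invr_ge0.
have /(congr1 val) : box x i = box y i by rewrite bxy.
rewrite !ffunE /=; set X := x%:R * _; set Y := y%:R * _ => e.
have bnd (Z : R) : let t : R := (Num.truncn (N.+1%:R * fr Z))%:R in
    t <= N.+1%:R * fr Z < t + 1.
  have /andP[f0 f1] := fr_itv Z.
  have h : 0 <= N.+1%:R * fr Z by rewrite mulr_ge0.
  by rewrite /= natr1 truncn_itv.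
have := bnd X; have := bnd Y; rewrite /= e /fr.
set T := (_)%:R => /andP[a1 a2] /andP[b1 b2].
have NN : N.+1%:R * N.+1%:R^-1 = 1 :> R by rewrite divff.
have N0 : 0 < N.+1%:R^-1 :> R by rewrite invr_gt0.
have N1 : 0 < N.+1%:R :> R by [].
(* Equal cells: both fractional parts, scaled by N, lie in [T, T + 1). *)
rewrite -(ler_pM2l N1) NN -{1}(gtr0_norm N1) -normrM ler_norml.
apply/andP; split; nra.
Qed.

(** There are (Y + 1) ^ (n + 1) vectors with entries in [0, Y], while their
    products with w take at most 2 (n + 1) Y W + 1 values; the difference of two
    vectors with the same product is a solution. *)
Lemma siegel_one_equation n (w : 'I_n.+1 -> int) (W Y : nat) :
  (forall k, `|w k| <= W%:Z) -> (0 < Y)%N -> (2 * n.+1 * W < Y.+1 ^ n)%N ->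
  exists y : 'I_n.+1 -> int,
    [/\ exists k, y k != 0, forall k, `|y k| <= Y%:Z
      & \sum_k y k * w k = 0].
Proof.
move=> wW Y0 ltWY; 
pose S (c : {ffun 'I_n.+1 -> 'I_Y.+1}) : int := \sum_k (c k)%:Z * w k.
have S_bnd c : `|S c| <= (n.+1 * (Y * W))%N%:Z.
  apply: le_trans (ler_norm_sum _ _ _) _.
  have -> : (n.+1 * (Y * W))%N%:Z = \sum_(i < n.+1) (Y * W)%N%:Z.
    by rewrite sumr_const card_ord -mulr_natl natz -PoszM.
  apply: ler_sum => i _; rewrite normrM PoszM.
  by apply: ler_pM => //; have := ltn_ord (c i); lia.
(* Adding the bound makes the value of S a natural number. *)
have SK c : (absz (S c + (n.+1 * (Y * W))%N%:Z)%R < (2 * n.+1 * (Y * W)).+1)%N.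
  by have := S_bnd c; lia.
have [|x [y [xy Sxy]]] := @pigeonhole _ _ (fun c => Ordinal (SK c)).
  rewrite card_ffun !card_ord expnS.
  apply: (@leq_trans (Y.+1 * (2 * n.+1 * W).+1)%N); first by nia.
  by rewrite leq_mul.
have {}Sxy : S x = S y.
  by have := congr1 val Sxy; have := S_bnd x; have := S_bnd y; rewrite /=; lia.
exists (fun k => (x k)%:Z - (y k)%:Z); split.
- apply: contrapT => /forallNP x_eq_y; case/eqP: xy; apply/ffunP => k.
  by apply/val_inj; have /negP := x_eq_y k; rewrite negbK subr_eq0 => /eqP[].
- by move=> k; have := ltn_ord (x k); have := ltn_ord (y k); lia.
- transitivity (S x - S y); last by rewrite Sxy subrr.
  rewrite /S -sumrB.
  by apply: eq_bigr => k _; rewrite mulrBl.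
Qed.

(** * Unbounded families of good approximations *)

(** What forces the denominators in Dirichlet's theorem to be unbounded: those
    at most B cannot reach precision d. *)
Lemma irrational_gap (R : realType) (x : R) B :
  (forall (q : nat) (p : int), (0 < q)%N -> q%:R * x <> p%:~R) ->
  exists2 d : R, 0 < d & forall (q : nat) (p : int), (0 < q <= B)%N ->
    d <= `|p%:~R - q%:R * x|.
Proof.
move=> irr; elim: B => [|B [d d0 dP]].
  by exists 1 => // q p /andP[q0]; rewrite leqNgt q0.
set y := B.+1%:R * x; pose f := Num.floor y.
have /andP[fl fu] : f%:~R <= y < (f + 1)%:~R := floor_itv y.
have {}fl : f%:~R < y.
  rewrite lt_neqAle fl andbT; apply/eqP => e.
  exact: (irr B.+1 f isT (esym e)).
exists (Num.min d (Num.min (y - f%:~R) ((f + 1)%:~R - y))).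
  by rewrite !lt_min d0 !subr_gt0 fl fu.
move=> q p /andP[q0]; rewrite leq_eqVlt ltnS => /predU1P[->|qB]; last first.
  by rewrite ge_min dP// q0.
rewrite !ge_min; apply/orP; right; rewrite -/y.
have [pf|fp] := leP p f; apply/orP; [left|right].
  have : p%:~R <= f%:~R :> R by rewrite ler_int.
  move=> h; rewrite distrC; apply: le_trans (ler_norm _).
  by rewrite lerD2l lerN2.
have : (f + 1)%:~R <= p%:~R :> R by rewrite ler_int -ltzD1 ltrD2r.
by move=> h; apply: le_trans (ler_norm _); rewrite lerD2r.
Qed.

(** Linear independence over the integers, which is equivalent to linear
    independence over the rationals. *)
Definition int_free (R : realType) n (A : 'I_n.+1 -> R) :=
  forall y : 'I_n.+1 -> int, \sum_k (y k)%:~R * A k = 0 -> forall k, y k = 0.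

Lemma int_free_irrational (R : realType) n (A : 'I_n.+1 -> R) i :
  A ord0 = 1 -> int_free A -> i != ord0 ->
  forall (q : nat) (p : int), (0 < q)%N -> q%:R * A i <> p%:~R.
Proof.
move=> A0 freeA i0 q p q_gt0 eq_qp.
pose y k : int := if k == i then q%:Z else if k == ord0 then - p else 0.
have : \sum_k (y k)%:~R * A k = 0.
  rewrite (bigD1 i)// (bigD1 ord0) 1?eq_sym//= big1 => [|k /andP[ki k0]].
    rewrite /y eqxx (negPf (_ : ord0 != i)) 1?eq_sym// eqxx A0 eq_qp.
    by rewrite intrN mulr1 addr0 subrr.
  by rewrite /y (negPf ki) (negPf k0) mul0r.
move=> /freeA/(_ i); rewrite /y eqxx => -[q0].
by rewrite q0 in q_gt0.
Qed.

(** The natural number r plays the role of the n-th root of the denominator q,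
    up to a factor 2; it keeps all estimates free of real exponents. *)
Definition approximant (R : realType) n (A : 'I_n.+1 -> R) (r q : nat)
    (w : 'I_n.+1 -> int) :=
  [/\ (0 < q <= r ^ n)%N, (r ^ n <= 2 ^ n * q)%N
    & forall k, `|(w k)%:~R - q%:R * A k| <= r%:R^-1].

Lemma approximants_unbounded (R : realType) n (A : 'I_n.+1 -> R) B :
  (0 < n)%N -> A ord0 = 1 -> int_free A ->
  exists r q w, (B <= r)%N /\ approximant A r q w.
Proof.
move=> n0 A0 freeA.
pose i1 : 'I_n.+1 := inord 1.
have i10 : i1 != ord0 by rewrite -val_eqE /= inordK.
have [d d0 dP] := irrational_gap (B ^ n) (int_free_irrational A0 freeA i10).
pose N := (Num.truncn d^-1).+1.
have dN : N%:R^-1 < d by rewrite invf_plt ?posrE// truncnS_gt.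
have [q [w [/andP[q0 qN] wP]]] :=
  dirichlet_simultaneous A0 (ltn0Sn _ : 0 < N)%N.
have Bq : (B ^ n < q)%N.
  rewrite ltnNge; apply/negP => qB; have := wP i1.
  by rewrite leNgt (lt_le_trans dN)// dP// q0.
have [|r qr rmin] := @ex_minnP (fun r => q <= r ^ n)%N; first by exists N.
have Br : (B < r)%N by rewrite -(ltn_exp2r _ _ n0) (leq_trans Bq).
(* By minimality (r - 1) ^ n < q, and r <= 2 (r - 1) unless r = 1. *)
exists r, q, w; split; first exact: ltnW.
split; rewrite ?q0//.
- have r1q : (r.-1 ^ n <= q)%N.
    rewrite leqNgt; apply/negP => /ltnW/rmin; lia.
  case: (ltngtP r 1) => r1; first lia; last first.
    by rewrite r1 exp1n muln_gt0 expn_gt0.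
  apply: (@leq_trans ((2 * r.-1) ^ n)); first by rewrite leq_exp2r//; lia.
  by rewrite expnMn leq_mul.
- move=> k; apply: le_trans (wP k) _.
  by rewrite lef_pV2 ?posrE ?ltr0n ?ler_nat ?rmin//; lia.
Qed.

(** * Multiplying an approximation by a field element *)

(** The matrix with entries sum_i y_i t_ijk, for row j and column k, represents
    multiplication by D eta, so it sends A to D eta A. Writing
    w = q A + e, the main term q A is mapped to an exact multiple of A, and
    both errors come from e alone: the j-th one is the difference between
    D (y . e) A_j and the j-th coordinate of the image of e. *)
Lemma multiplied_approximation (R : realType) n (A : 'I_n.+1 -> R) (D : nat)
    (t : 'I_n.+1 -> 'I_n.+1 -> 'I_n.+1 -> int) (M T Y q eps : R)
    (y w : 'I_n.+1 -> int) :
  (forall i j, D%:R * (A i * A j) = \sum_k (t i j k)%:~R * A k) ->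
  (forall i, `|A i| <= M) -> (forall i j k, `|(t i j k)%:~R| <= T) ->
  (forall k, `|(y k)%:~R| <= Y) -> (forall k, `|(w k)%:~R - q * A k| <= eps) ->
  let Q := (D%:Z * \sum_k y k * w k)%:~R in
  let eta := \sum_k (y k)%:~R * A k in
  `|Q - D%:R * q * eta| <= D%:R * (n.+1%:R * (Y * eps)) /\
  forall j, `|Q * A j - (\sum_i \sum_k y i * t i j k * w k)%:~R|
    <= (D%:R * n.+1%:R * M + n.+1%:R ^+ 2 * T) * (Y * eps).
Proof.
move=> tP AM tT yY weps Q eta; pose e k := (w k)%:~R - q * A k.
have eP k : `|e k| <= eps := weps k.
have wE k : (w k)%:~R = q * A k + e k by rewrite /e; ring.
have sumE c : \sum_(k < n.+1) c = n.+1%:R * c :> R.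
  by rewrite sumr_const card_ord mulr_natl.
pose S := \sum_k (y k)%:~R * e k.
have SY : `|S| <= n.+1%:R * (Y * eps).
  apply: le_trans (ler_norm_sum _ _ _) _.
  rewrite -sumE.
  by apply: ler_sum => k _; rewrite normrM ler_pM.
have QE : Q = D%:R * q * eta + D%:R * S.
  rewrite /Q intrM rmorph_sum/= -mulrA -mulrDr; congr (_ * _).
  rewrite mulr_sumr -big_split; apply: eq_bigr => k _ /=.
  by rewrite intrM wE; ring.
split=> [|j]; first by rewrite QE addrC addKr normrM normr_nat ler_wpM2l.
pose S' := \sum_i \sum_k (y i)%:~R * (t i j k)%:~R * e k.
have -> : (\sum_i \sum_k y i * t i j k * w k)%:~R = D%:R * q * eta * A j + S'.
  rewrite rmorph_sum/= mulr_sumr mulr_suml -big_split; apply: eq_bigr => i _ /=.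
  rewrite rmorph_sum/=.
  have -> : D%:R * q * ((y i)%:~R * A i) * A j =
      \sum_k (y i)%:~R * (t i j k)%:~R * (q * A k).
    transitivity (q * (y i)%:~R * (D%:R * (A i * A j))); first by ring.
    by rewrite tP mulr_sumr; apply: eq_bigr => k _; ring.
  by rewrite -big_split; apply: eq_bigr => k _ /=; rewrite !intrM wE; ring.
have S'Y : `|S'| <= n.+1%:R ^+ 2 * T * (Y * eps).
  apply: le_trans (ler_norm_sum _ _ _) _.
  rewrite expr2 -!mulrA -sumE.
  apply: ler_sum => i _; apply: le_trans (ler_norm_sum _ _ _) _.
  rewrite -sumE.
  apply: ler_sum => k _; rewrite !normrM mulrCA mulrA.
  by rewrite ler_pM ?mulr_ge0// ler_pM.
rewrite QE mulrDl opprD addrACA subrr add0r mulrDl.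
apply: le_trans (ler_normB _ _) _; apply: lerD => //.
rewrite !normrM normr_nat.
rewrite [leRHS](_ : _ = D%:R * (n.+1%:R * (Y * eps)) * M); last by ring.
by rewrite ler_pM// ?mulr_ge0// ler_wpM2l.
Qed.

Lemma approximant_gt0 (R : realType) n (A : 'I_n.+1 -> R) (r q : nat)
    (w : 'I_n.+1 -> int) :
  (0 < n)%N -> approximant A r q w -> (0 < r)%N.
Proof.
by case: r => // n0 [/andP[q0]]; rewrite exp0n// leqNgt q0.
Qed.

(** Siegel's lemma gives |y| = O(q ^ (1 / n)) = O(r). The form y . A is then
    much smaller than |y|: as y . w = 0, the product q (y . A) equals
    - y . (w - q A), which is O(r * 1 / r). *)
Lemma orthogonal_vector (R : realType) n (A : 'I_n.+1 -> R) (M r q : nat)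
    (w : 'I_n.+1 -> int) :
  (0 < n)%N -> (forall k, `|A k| <= M%:R) -> approximant A r q w ->
  let c := (2 * n.+1 * M.+1).+1 in
  exists y : 'I_n.+1 -> int,
    [/\ exists k, y k != 0, forall k, `|y k| <= (c * r)%N%:Z,
        \sum_k y k * w k = 0
      & `|\sum_k (y k)%:~R * A k| <= (n.+1 * c * 2 ^ n)%:R / r%:R ^+ n].
Proof.
move=> n0 AM rqw c; have r0 := approximant_gt0 n0 rqw.
have [/andP[q0 qr] rq wP] := rqw.
have r0R : 0 < r%:R :> R by rewrite ltr0n.
have w_le k : `|w k| <= (M.+1 * q)%N%:Z.
  have : `|(w k)%:~R| <= (M.+1 * q)%:R :> R.
    have := lerD (wP k) (lexx `|q%:R * A k|).
    move/(le_trans (ler_normD _ _)); rewrite subrK => /le_trans; apply.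
    rewrite mulSn natrD natrM; apply: lerD.
      by apply: (@le_trans _ _ 1); rewrite ?invf_le1 ?ler1n.
    by rewrite normrM normr_nat mulrC ler_wpM2r.
  by rewrite -intr_norm -[X in _ <= X]/((M.+1 * q)%N%:Z%:~R) ler_int.
have [||y [y0 yY yw]] := siegel_one_equation (Y := (c * r)%N) w_le.
- by rewrite muln_gt0.
- apply: (@leq_ltn_trans ((c * r) ^ n)); last by rewrite ltn_exp2r.
  rewrite expnMn mulnA; apply: leq_mul => //.
  by rewrite (@leq_trans (c ^ 1))// leq_pexp2l.
exists y; split=> //; set eta := \sum_k _.
pose e k := (w k)%:~R - q%:R * A k.
have qeta : q%:R * eta = - \sum_k (y k)%:~R * e k.
  have /(congr1 (fun z : int => z%:~R : R)) := yw.
  rewrite rmorph_sum mulr0z /= => ywR.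
  transitivity (\sum_k (y k * w k)%:~R - \sum_k (y k)%:~R * e k); last first.
    by rewrite ywR sub0r.
  rewrite /eta mulr_sumr -sumrN -big_split.
  by apply: eq_bigr => k _ /=; rewrite intrM /e; ring.
have : q%:R * `|eta| <= (n.+1 * c)%:R.
  rewrite -[X in X * _]normr_nat -normrM qeta normrN.
  apply: le_trans (ler_norm_sum _ _ _) _.
  apply: (@le_trans _ _ (\sum_(k < n.+1) (c * r)%:R * r%:R^-1)).
    apply: ler_sum => k _; rewrite normrM; apply: ler_pM => //; last exact: wP.
    by rewrite -intr_norm -[X in _ <= X]/((c * r)%N%:Z%:~R) ler_int.
  by rewrite sumr_const card_ord -[X in X <= _]mulr_natl !natrM mulfK ?gt_eqF.
have q0R : 0 < q%:R :> R by rewrite ltr0n.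
rewrite mulrC -ler_pdivlMr// => /le_trans; apply.
rewrite [X in _ <= X / _]natrM -mulrA ler_wpM2l//.
rewrite ler_pdivlMr ?exprn_gt0// mulrC ler_pdivrMr//.
by rewrite -natrX -natrM ler_nat.
Qed.

(** The constant C is chosen before l: the approximation (r, q, w) selected
    modulo l enters the estimates only through the ratio rho = r' / r, which
    cancels. *)
Lemma approximant_multiple (R : realType) n (A : 'I_n.+1 -> R) (D : nat)
    (t : 'I_n.+1 -> 'I_n.+1 -> 'I_n.+1 -> int) :
  (0 < n)%N -> A ord0 = 1 -> int_free A -> (0 < D)%N ->
  (forall i j, D%:R * (A i * A j) = \sum_k (t i j k)%:~R * A k) ->
  exists C : R, forall l B : nat, (0 < l)%N ->
    exists (k : nat) (z : 'I_n.+1 -> int) (e : R),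
      [/\ (B <= k)%N, 0 <= e,
          forall j, `|(k.+1 * l)%:R * A j - (z j)%:~R| <= e
        & (k.+1 * l)%:R * e ^+ n <= C].
Proof.
move=> n0 A0 freeA D0 tP.
have [M AM] : exists M : nat, forall k, `|A k| <= M%:R.
  exists (\max_k (Num.truncn `|A k|).+1)%N => k.
  apply/ltW/(lt_le_trans (truncnS_gt _)); rewrite ler_nat.
  exact: (leq_bigmax (F := fun k => (Num.truncn `|A k|).+1)).
have [T tT] : exists T : nat, forall i j k, `|(t i j k)%:~R| <= T%:R :> R.
  pose F (x : 'I_n.+1 * 'I_n.+1 * 'I_n.+1) := `|t x.1.1 x.1.2 x.2|%N.
  exists (\max_x F x)%N => i j k.
  rewrite -intr_norm -[X in X <= _]/(`|t i j k|%N%:R) ler_nat.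
  exact: (leq_bigmax (F := F) (i, j, k)).
pose c := (2 * n.+1 * M.+1).+1.
pose H : R := (n.+1 * c * 2 ^ n)%:R.
pose G : R := (D * (n.+1 * c))%:R.
pose E : R := (D%:R * n.+1%:R * M%:R + n.+1%:R ^+ 2 * T%:R) * c%:R.
exists ((D%:R * H + G) * E ^+ n) => l B l0.
(* Among approximations with r' as large as desired, select by pigeonhole
   one congruence class modulo l, then its representative w. *)
have /choice[s sP] m : exists x : nat * nat * ('I_n.+1 -> int),
    (m <= x.1.1)%N /\ approximant A x.1.1 x.1.2 x.2.
  have [r [q [w rqw]]] := approximants_unbounded m n0 A0 freeA.
  by exists (r, q, w).
pose res m : {ffun 'I_n.+1 -> 'I_l} :=
  [ffun k => Ordinal (ltn_pmod `|((s m).2 k %% l)%Z|%N l0)].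
have [v vP] := infinite_pigeonhole res.
have [i _ iv] := vP 0%N; have [_] := sP i.
move: iv; rewrite /res; case: (s i) => -[r q] w /= iv rqw.
have r0 := approximant_gt0 n0 rqw.
have [y [[k0 yk0] yY yw]] := orthogonal_vector n0 AM rqw.
rewrite -/c -/H; set eta := \sum_k _ => etaH.
have eta0 : 0 < `|eta|.
  by rewrite normr_gt0; apply: contra yk0 => /eqP/freeA ->.
(* The threshold on r' beyond which |Q| >= (B + 1) l. *)
have [m mP] : exists m : nat, 2 ^+ n * ((B.+1 * l)%:R + G) / `|eta| <= m%:R.
  exists (Num.truncn (2 ^+ n * ((B.+1 * l)%:R + G) / `|eta|)).+1.
  exact/ltW/truncnS_gt.
have [j mj jv] := vP (maxn r m); have [jr] := sP j.
move: jv jr; rewrite /res; case: (s j) => -[r' q'] w' /= jv jr rqw'.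
have [rr' mr'] : (r <= r')%N /\ (m <= r')%N by lia.
have r'0 : (0 < r')%N by lia.
have [/andP[q'0 q'r'] r'q' w'P] := rqw'.
have yYR k : `|(y k)%:~R| <= (c * r)%:R :> R.
  by rewrite -intr_norm -[X in _ <= X]/((c * r)%N%:Z%:~R) ler_int.
have := multiplied_approximation tP AM tT yYR w'P; rewrite -/eta.
set Q := D%:Z * _ => -[Q_eta Q_z].
have lQ : (l%:Z %| Q)%Z.
  apply: dvdz_mull.
  have -> : \sum_k y k * w' k = \sum_k y k * (w' k - w k).
    transitivity (\sum_k y k * w' k - \sum_k y k * w k).
      by rewrite yw subr0.
    by rewrite -sumrB; apply: eq_bigr => k _; rewrite mulrBr.
  apply: rpred_sum => k _; apply: dvdz_mull.
  rewrite -eqz_mod_dvd; apply/eqP.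
  have l_neq0 : l%:Z != 0 by lia.
  have := congr1 (fun f : {ffun _ -> _} => val (f k)) (etrans jv (esym iv)).
  rewrite !ffunE /= !modn_small; last 2 first.
  - by have := ltz_mod (w k) l_neq0; have := modz_ge0 (w k) l_neq0; lia.
  - by have := ltz_mod (w' k) l_neq0; have := modz_ge0 (w' k) l_neq0; lia.
  by have := modz_ge0 (w k) l_neq0; have := modz_ge0 (w' k) l_neq0; lia.
have r0R : 0 < r%:R :> R by rewrite ltr0n.
have r'0R : 0 < r'%:R :> R by rewrite ltr0n.
pose rho : R := r'%:R / r%:R.
have rho1 : 1 <= rho by rewrite ler_pdivlMr// mul1r ler_nat.
have rho0 : 0 < rho by exact: lt_le_trans rho1.
have YE : (c * r)%:R * r'%:R^-1 = c%:R * rho^-1 :> R.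
  by rewrite natrM invf_div mulrA.
have {}Q_eta : `|Q%:~R - D%:R * q'%:R * eta| <= G.
  apply: le_trans Q_eta _; rewrite YE /G !natrM.
  by rewrite !ler_wpM2l// ler_piMr// invf_le1.
have {Q_z}Q_z z : `|Q%:~R * A z - (\sum_i \sum_k y i * t i z k * w' k)%:~R|
    <= E * rho^-1.
  by apply: le_trans (Q_z z) _; rewrite YE /E mulrA.
have Q_ge : D%:R * (q'%:R * `|eta|) - G <= `|Q%:~R|.
  have -> : D%:R * (q'%:R * `|eta|) = `|D%:R * q'%:R * eta|.
    by rewrite !normrM !normr_nat mulrA.
  have := ler_normB (Q%:~R) (Q%:~R - D%:R * q'%:R * eta).
  by rewrite opprB addrC subrK; lra.
(* The O(1) term G is absorbed into G rho ^ n because rho >= 1. *)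
have Q_le : `|Q%:~R| <= (D%:R * H + G) * rho ^+ n.
  have := ler_normD (Q%:~R - D%:R * q'%:R * eta) (D%:R * q'%:R * eta).
  rewrite subrK mulrDl => /le_trans; apply; rewrite addrC; apply: lerD.
    rewrite !normrM !normr_nat -!mulrA ler_wpM2l//.
    rewrite /rho expr_div_n mulrCA; apply: ler_pM => //.
    by rewrite -natrX ler_nat.
  by apply: (le_trans Q_eta); rewrite ler_peMr// exprn_ege1.
have Q_big : (B.+1 * l)%:R <= `|Q%:~R| :> R.
  apply: le_trans Q_ge; rewrite lerBrDr.
  have h : (B.+1 * l)%:R + G <= q'%:R * `|eta|.
    have : m%:R * 2 ^- n <= q'%:R :> R.
      rewrite ler_pdivrMr ?exprn_gt0// mulrC -natrX -natrM ler_nat.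
      rewrite (leq_trans mr')// (leq_trans _ r'q')//.
      by rewrite -{1}[r']expn1 leq_pexp2l.
    rewrite -(ler_pM2r eta0) => /(le_trans _); apply.
    by rewrite mulrAC ler_pdivlMr ?exprn_gt0// mulrC -ler_pdivrMr.
  apply: le_trans h _; rewrite ler_peMl// ?mulr_ge0// ler1n//.
have Q0 : Q != 0. 
  apply/eqP => Q0; move: Q_big.
  by rewrite Q0 normr0 lern0 muln_eq0 [l == _]eqn0Ngt l0.
have QE : `|Q%:~R| = `|Q|%N%:R :> R by rewrite -intr_norm.
have /dvdnP[k Qk] : (l %| `|Q|)%N by [].
have Bk : (B < k)%N.
  by move: Q_big; rewrite QE ler_nat Qk leq_pmul2r.
have E0 : 0 <= E.
  by rewrite /E mulr_ge0// addr_ge0// mulr_ge0 ?mulr_ge0// exprn_ge0.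
(* Q may be negative: the whole vector is multiplied by its sign. *)
exists k.-1, (fun z => sgz Q * \sum_i \sum_k y i * t i z k * w' k).
exists (E * rho^-1).
rewrite prednK ?(leq_ltn_trans _ Bk)// -Qk -QE; split.
- by rewrite -ltnS prednK// (leq_ltn_trans _ Bk).
- by rewrite divr_ge0// ltW.
- move=> z; rewrite [`|Q%:~R|]normrEsg intrM -[sgz Q]sgrz intr_sg.
  by rewrite -mulrA -mulrBr normrM normr_sg intr_eq0 Q0 mul1r.
- apply: (@le_trans _ _ ((D%:R * H + G) * rho ^+ n * (E * rho^-1) ^+ n)).
    by rewrite ler_wpM2r// exprn_ge0// divr_ge0// ltW.
  rewrite [(E * _) ^+ n]exprMn exprVn mulrACA -mulrA mulfV ?mulr1//.
  by rewrite expf_neq0// gt_eqF.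
Qed.

(** * Number fields *)

Definition cons1 (R : realType) n (a : 'rV[R]_n) (k : 'I_n.+1) : R :=
  if unlift ord0 k is Some i then a 0 i else 1.

Lemma cons1_0 (R : realType) n (a : 'rV[R]_n) : cons1 a ord0 = 1.
Proof. by rewrite /cons1 unlift_none. Qed.

Lemma cons1_lift (R : realType) n (a : 'rV[R]_n) i :
  cons1 a (lift ord0 i) = a 0 i.
Proof. by rewrite /cons1 liftK. Qed.

Lemma qspan1E (R : realType) n (a : 'rV[R]_n) x :
  qspan1 a x <-> exists c : 'I_n.+1 -> rat, x = \sum_k ratr (c k) * cons1 a k.
Proof.
split=> [[q0 [q ->]]|[c ->]].
  exists (fun k => if unlift ord0 k is Some i then q 0 i else q0).
  rewrite big_ord_recl unlift_none cons1_0 mulr1; congr (_ + _).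
  by apply: eq_bigr => i _; rewrite liftK cons1_lift.
exists (c ord0), (\row_i c (lift ord0 i)).
rewrite big_ord_recl cons1_0 mulr1; congr (_ + _).
by apply: eq_bigr => i _; rewrite mxE cons1_lift.
Qed.

Lemma common_denominator (I : finType) (c : I -> rat) :
  exists (D : nat) (t : I -> int),
    (0 < D)%N /\ forall x, D%:R * c x = (t x)%:~R.
Proof.
exists (\prod_x `|denq (c x)|)%N.
exists (fun x => numq (c x) * (\prod_(y | y != x) `|denq (c y)|)%N%:Z).
split=> [|x]; first by rewrite prodn_gt0// => x; rewrite absz_gt0 denq_neq0.
rewrite (bigD1 x)//= natrM mulrAC intrM; congr (_ * _).
by rewrite mulrC -[X in _ * X]/(`|denq (c x)|%N%:Z%:~R) absz_denq numqE.
Qed.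

(** The degree condition enters here: n + 1 generators of a space of dimension
    n + 1 are free. The structure constants of the field in this basis become
    integers after multiplication by a common denominator. *)
Lemma joint_algebraic_basis (R : realType) n (a : 'rV[R]_n) :
  joint_algebraic_tuple a ->
  int_free (cons1 a) /\
  exists (D : nat) (t : 'I_n.+1 -> 'I_n.+1 -> 'I_n.+1 -> int),
    (0 < D)%N /\ forall i j,
      D%:R * (cons1 a i * cons1 a j) = \sum_k (t i j k)%:~R * cons1 a k.
Proof.
move=> [K [iota [iotaE dimK _]]].
have iotaZ (c : rat) x : iota (c *: x) = ratr c * iota x.
  rewrite -mulr_algl rmorphM; congr (_ * _).
  exact: (fmorph_eq_rat (iota \o in_alg K)).
have /choice[b bP] (k : 'I_n.+1) : exists y, iota y = cons1 a k.
  have [y _ <-] : range iota (cons1 a k); last by exists y.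
  rewrite iotaE; apply/qspan1E; exists (fun i => (i == k)%:R).
  rewrite (bigD1 k)//= eqxx rmorph1 mul1r big1 ?addr0// => i /negPf->.
  by rewrite rmorph0 mul0r.
have iota_sum (c : 'I_n.+1 -> rat) :
    iota (\sum_k c k *: b k) = \sum_k ratr (c k) * cons1 a k.
  by rewrite rmorph_sum; apply: eq_bigr => k _; rewrite iotaZ bP.
have /choice[co coP] x : exists c : 'I_n.+1 -> rat, x = \sum_k c k *: b k.
  have /qspan1E[c xE] : qspan1 a (iota x) by rewrite -iotaE; exists x.
  by exists c; apply: (fmorph_inj iota); rewrite iota_sum.
pose X := [tuple b i | i < n.+1].
have XE (k : 'I_n.+1) : X`_k = b k by rewrite -tnth_nth tnth_mktuple.
have X_free : free X.
  apply: (@basis_free _ _ {:K}); rewrite basisEdim size_tuple dimK leqnn andbT.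
  apply/subvP => x _; rewrite (coP x); apply: rpred_sum => k _.
  by apply/rpredZ/memv_span; rewrite -XE mem_nth ?size_tuple.
split.
  move=> y y0; have /freeP freeX := X_free.
  suff y0Q : forall k, (y k)%:~R = 0 :> rat.
    by move=> k; apply/eqP; rewrite -(intr_eq0 rat) y0Q.
  apply: freeX; apply: (fmorph_inj iota); rewrite rmorph0 -[RHS]y0.
  under eq_bigr do rewrite XE.
  by rewrite iota_sum; under eq_bigr do rewrite ratr_int.
pose prod_co (x : 'I_n.+1 * 'I_n.+1 * 'I_n.+1) := co (b x.1.1 * b x.1.2) x.2.
have [D [t [D0 tP]]] := common_denominator prod_co.
exists D, (fun i j k => t (i, j, k)); split=> // i j.
rewrite -!bP -rmorphM (coP (b i * b j)) iota_sum mulr_sumr.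
apply: eq_bigr => k _; rewrite mulrA; congr (_ * _).
by rewrite -ratr_nat -rmorphM/= (tP (i, j, k)) ratr_int.
Qed.

(** * Distances and limits inferior *)

Lemma dist_to_int_le (R : realType) n (v : 'rV[R]_n) (z : 'I_n -> int) (e : R) :
  0 <= e -> (forall i, `|v 0 i - (z i)%:~R| <= e) -> dist_to_int v <= e.
Proof.
move=> e0 ve; apply: (@le_trans _ _ `|v - map_mx intr (\row_i z i)|).
  apply: ge_inf; last by exists (\row_i z i).
  by exists 0 => _ [x _ <-].
rewrite [`|_|]mx_normrE; apply: bigmax_le => // -[i j] _ /=.
by rewrite ord1 !mxE.
Qed.

Lemma dist_to_int_ge0 (R : realType) n (v : 'rV[R]_n) : 0 <= dist_to_int v.
Proof.
by apply: lb_le_inf; [exists `|v - map_mx intr 0|, 0 | move=> _ [x _ <-]].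
Qed.

Lemma limn_einf_le_frequently (R : realType) (u : (\bar R)^nat) c :
  (forall B, exists2 k, (B <= k)%N & (u k <= c)%E) -> (limn_einf u <= c)%E.
Proof.
move=> uc; rewrite limn_einf_lim (cvg_lim _ (@cvg_einfs_sup _ u))//.
apply: ge_ereal_sup => _ [B _ <-]; have [k Bk] := uc B.
by apply: le_trans; apply: ereal_inf_lbound; exists k.
Qed.

Lemma limn_einf_ge0 (R : realType) (u : (\bar R)^nat) :
  (forall k, 0 <= u k)%E -> (0 <= limn_einf u)%E.
Proof.
move=> u0; rewrite limn_einf_lim (cvg_lim _ (@cvg_einfs_sup _ u))//.
apply: (@le_trans _ _ (einfs u 0)); last by apply: ereal_sup_ubound; exists 0%N.
by apply: le_ereal_inf_tmp => _ [k _ <-].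
Qed.

(** Arbitrarily large k with the required bound, for a constant uniform in l;
    the uniformity is what makes the p-adic statement a consequence. *)
Lemma joint_algebraic_multiple (R : realType) n (a : 'rV[R]_n) :
  (0 < n)%N -> joint_algebraic_tuple a ->
  exists2 C : R, 0 <= C & forall l B : nat, (0 < l)%N ->
    exists2 k : nat, (B <= k)%N &
      k.+1%:R `^ n%:R^-1 * dist_to_int ((k.+1 * l)%:R *: a)
        <= C / l%:R `^ n%:R^-1.
Proof.
move=> n0 /joint_algebraic_basis[freeA [D [t [D0 tP]]]].
have [C CP] := approximant_multiple n0 (cons1_0 a) freeA D0 tP.
exists (C `^ n%:R^-1) => [|l B l0]; first exact: powR_ge0.
have [k [z [e [Bk e0 ze keC]]]] := CP l B l0; exists k => //.
have l0R : 0 < l%:R `^ n%:R^-1 :> R by rewrite powR_gt0// ltr0n.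
rewrite ler_pdivlMr// mulrAC -powRM// -natrM.
have de : dist_to_int ((k.+1 * l)%:R *: a) <= e.
  apply: (@dist_to_int_le _ _ _ (fun i => z (lift ord0 i))) => // i.
  by rewrite mxE -cons1_lift.
apply: (@le_trans _ _ ((k.+1 * l)%:R `^ n%:R^-1 * e)).
  by rewrite ler_wpM2l// powR_ge0.
have -> : e = (e ^+ n) `^ n%:R^-1.
  by rewrite -powR_mulrn// -powRrM mulfV ?powRr1// pnatr_eq0 -lt0n.
have ke0 : 0 <= (k.+1 * l)%:R * e ^+ n by rewrite mulr_ge0// exprn_ge0.
rewrite -powRM ?exprn_ge0// ge0_ler_powR ?nnegrE ?invr_ge0//.
exact: le_trans ke0 keC.
Qed.

(* The sequences are indexed by k : nat, with k.+1 ranging over the positive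
   integers. *)
Theorem theorem1p10 (R : realType) (n : nat) (a : 'rV[R]_n)
    (n_gt0 : (0 < n)%N) (a_alg : joint_algebraic_tuple a) :
  (exists C : R, forall l : nat, (0 < l)%N ->
     (limn_einf (fun k : nat =>
        (k.+1%:R `^ n%:R^-1 * dist_to_int ((k.+1 * l)%:R *: a))%:E)
      <= (C / l%:R `^ n%:R^-1)%:E)%E)
  /\
  (forall p : nat, prime p ->
     limn_einf (fun k : nat =>
        ((k.+1%:R * padic_abs R p k.+1) `^ n%:R^-1
         * dist_to_int (k.+1%:R *: a))%:E) = 0%E).
Proof.
have [C C0 CP] := joint_algebraic_multiple n_gt0 a_alg.
split=> [|p p_prime].
  exists C => l l0; apply: limn_einf_le_frequently => B.
  by have [k Bk kC] := CP l B l0; exists k.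
apply/eqP; rewrite eq_le; apply/andP; split; last first.
  apply: limn_einf_ge0 => k; rewrite lee_fin.
  by rewrite mulr_ge0 ?powR_ge0 ?dist_to_int_ge0.
apply/lee_addgt0Pr => e e0; rewrite add0e.
apply: limn_einf_le_frequently => B.
have n0R : 0 <= n%:R^-1 :> R by rewrite invr_ge0.
(* Any m with p ^ m >= (C / e) ^ n works, for instance m >= (C / e) ^ n. *)
pose m := (Num.truncn ((C / e) ^+ n)).+1.
have p0 : (0 < p)%N by exact: prime_gt0.
have pm0 : (0 < p ^ m)%N by rewrite expn_gt0 p0.
have Ce : C / (p ^ m)%:R `^ n%:R^-1 <= e.
  rewrite ler_pdivrMr ?powR_gt0 ?ltr0n// mulrC -ler_pdivrMr//.
  have Ce0 : 0 <= C / e by rewrite divr_ge0// ltW.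
  have -> : C / e = ((C / e) ^+ n) `^ n%:R^-1.
    by rewrite -powR_mulrn// -powRrM mulfV ?powRr1// pnatr_eq0 -lt0n.
  rewrite ge0_ler_powR ?nnegrE ?exprn_ge0//.
  apply/ltW/(lt_trans (truncnS_gt _)).
  by rewrite ltr_nat ltn_expl// prime_gt1.
have [k Bk kC] := CP _ B pm0.
have kE : (k.+1 * p ^ m).-1.+1 = (k.+1 * p ^ m)%N by rewrite prednK// muln_gt0.
exists (k.+1 * p ^ m).-1.
  by rewrite (leq_trans Bk)// -ltnS kE leq_pmulr.
rewrite kE lee_fin; apply: le_trans (le_trans kC Ce).
rewrite ler_wpM2r ?dist_to_int_ge0// ge0_ler_powR// ?nnegrE.
- by rewrite mulr_ge0// /padic_abs; case: ifP.
- exact: ler0n.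
- rewrite /padic_abs; case: ifP => _; first by rewrite mulr0.
  rewrite natrM -mulrA ler_piMr//.
  rewrite ler_pdivrMr ?exprn_gt0 ?ltr0n// mul1r -natrX ler_nat leq_pexp2l//.
  by rewrite lognM// pfactorK// leq_addl.
Qed.
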